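(* Consider the system $x(s+1)=(1-a(s))x(s)+a(s)[P(s)x(s)+u(s)]$, $s=0,1,\ldots$, in $\mathbb{R}^n$, satisfying (A1). Then: i) If $\widetilde{\rho}_{\max}(P)>1$, or $\widetilde{\rho}_{\max}(P)=1$ but (A3) does not hold, there exist some initial states such that $x(s)$ is not mean-square convergent for any $\{a(s)\}$ satisfying (A2). ii) If $\widetilde{\rho}_{\min}(P)<1$, or $\widetilde{\rho}_{\min}(P)=1$ but (A3) does not hold, there exist some initial states such that $x(s)$ is not mean-square convergent for any $\{a(s)\}$ satisfying (A2').
   Context: Here $P(s)\in\mathbb{R}^{n\times n}$ and $u(s)\in\mathbb{R}^n$, $s\ge 0$, are random matrices and vectors on a common probability space, $a(s)\in\mathbb{R}$ is the gain, and $x(0)\in\mathbb{R}^n$ is the initial state. For $A\in\mathbb{R}^{n\times n}$ with eigenvalues $\lambda_i(A)$, $\widetilde{\rho}_{\max}(A):=\max_i \mathrm{Re}(\lambda_i(A))$ and $\widetilde{\rho}_{\min}(A):=\min_i\mathrm{Re}(\lambda_i(A))$. (A1): there exist a matrix $P\in\mathbb{R}^{n\times n}$ and a vector $u\in\mathbb{R}^n$ such that $\mathbb{E}[P(s)\,|\,x(s)]=P$ and $\mathbb{E}[u(s)\,|\,x(s)]=u$ for any $s\ge 0$ and $x(s)\in\mathbb{R}^n$; also $\mathbb{E}[\|P(s)\|_2^2\,|\,x(s)]$ and $\mathbb{E}[\|u(s)\|_2^2\,|\,x(s)]$ are uniformly bounded. (A2): $\{a(s)\}$ are non-negative real numbers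 independent of $\{x(s)\}$ with $\sum_{s=0}^\infty a(s)=\infty$ and $\sum_{s=0}^\infty a^2(s)<\infty$. (A2'): $\{a(s)\}$ are non-positive real numbers independent of $\{x(s)\}$ with $\sum_{s=0}^\infty a(s)=-\infty$ and $\sum_{s=0}^\infty a^2(s)<\infty$. (A3): any eigenvalue of $P$ whose real part is $1$ equals $1$, the eigenvalue $1$ has the same algebraic and geometric multiplicities, and $\xi^T u=0$ for any left eigenvector $\xi^T$ of $P$ corresponding to the eigenvalue $1$. $\{x(s)\}$ is mean-square convergent if there exists an $n$-dimensional random vector $x$ with $\mathbb{E}\|x\|_2^2<\infty$ and $\lim_{s\to\infty}\mathbb{E}\|x(s)-x\|_2^2=0$. *)

(* Defs.v *)
From HB Require Import structures.
From mathcomp Require Import all_boot all_order all_algebra.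
From mathcomp Require Import all_classical all_reals all_analysis.
From mathcomp Require Import complex.

Set Implicit Arguments.
Unset Strict Implicit.
Unset Printing Implicit Defensive.

Import Order.TTheory GRing.Theory Num.Theory.
Import numFieldNormedType.Exports.

Local Open Scope classical_set_scope.
Local Open Scope ring_scope.

Section Spectrum.
Context {R : realType} {n : nat}.

Definition cmx {p q : nat} (A : 'M[R]_(p, q)) : 'M[R[i]]_(p, q) :=
  map_mx (real_complex R) A.

(* [eigenvalue] is taken over R[i]; for n > 0 this set of real parts is finite
   and nonempty, so that its sup and inf are a max and a min. *)
Definition eigen_Re (A : 'M[R]_n) : set R :=
  [set complex.Re l | l in [set l : R[i] | eigenvalue (cmx A) l]].

Definition rho_max (A : 'M[R]_n) : R := sup (eigen_Re A).
Definition rho_min (A : 'M[R]_n) : R := inf (eigen_Re A).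

Definition A3 (P : 'M[R]_n) (u : 'cV[R]_n) : Prop :=
  [/\ forall l : R[i], eigenvalue (cmx P) l -> complex.Re l = 1 -> l = 1,
      mup 1 (char_poly (cmx P)) = \rank (eigenspace (cmx P) 1)
    & forall xi : 'rV[R[i]]_n,
        xi != 0 -> xi *m cmx P = xi -> xi *m cmx u = 0].

End Spectrum.

Section Gains.
Context {R : realType}.

Definition A2 (a : nat -> R) : Prop :=
  [/\ forall s, 0 <= a s,
      series a @ \oo --> +oo
    & cvgn (series (fun s => a s ^+ 2))].

Definition A2' (a : nat -> R) : Prop :=
  [/\ forall s, a s <= 0,
      series a @ \oo --> -oo
    & cvgn (series (fun s => a s ^+ 2))].

End Gains.

Section Norms.
Context {R : realType} {n : nat}.

(* The norm that the library puts on matrices is the sup norm. *)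
Definition norm2 (v : 'cV[R]_n) : R := Num.sqrt (\sum_i v i 0 ^+ 2).

Definition mxnorm2 (A : 'M[R]_n) : R :=
  sup [set norm2 (A *m v) | v in [set v : 'cV[R]_n | norm2 v <= 1]].

End Norms.

Section Random.
Context {d : measure_display} {T : measurableType d} {R : realType}.
Variable Pr : probability T R.

Definition random_mx {p q : nat} (X : T -> 'M[R]_(p, q)) : Prop :=
  forall i j, measurable_fun [set: T] (fun w => X w i j).

(* sigma(X): the coordinates generate the Borel sets of R^n. *)
Definition sigma_of {n : nat} (X : T -> 'cV[R]_n) : set (set T) :=
  g_sigma_preimage (fun (i : 'I_n) (w : T) => X w i 0).

(* Y is a version of E[X | G]. *)
Definition is_cond_exp (G : set (set T)) (X Y : T -> R) : Prop :=
  [/\ Pr.-integrable [set: T] (EFin \o X),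
      Pr.-integrable [set: T] (EFin \o Y),
      forall B : set R, measurable B -> G (Y @^-1` B)
    & forall A, G A ->
        (\int[Pr]_(w in A) (Y w)%:E = \int[Pr]_(w in A) (X w)%:E)%E].

(* E[X | G] = M almost surely, for a constant matrix M. *)
Definition cond_exp_mx_eq {p q : nat} (G : set (set T))
    (X : T -> 'M[R]_(p, q)) (M : 'M[R]_(p, q)) : Prop :=
  forall i j, is_cond_exp G (fun w => X w i j) (fun=> M i j).

(* E[X | G] <= C almost surely.  For X >= 0 a bounded conditional expectation
   forces X to be integrable, so [is_cond_exp] loses no generality here. *)
Definition cond_exp_le (G : set (set T)) (X : T -> R) (C : R) : Prop :=
  exists2 Y, is_cond_exp G X Y & {ae Pr, forall w, Y w <= C}.

Definition A1 {n : nat} (Ps : nat -> T -> 'M[R]_n) (us : nat -> T -> 'cV[R]_n)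
    (x : nat -> T -> 'cV[R]_n) (P : 'M[R]_n) (u : 'cV[R]_n) : Prop :=
  [/\ forall s, cond_exp_mx_eq (sigma_of (x s)) (Ps s) P,
      forall s, cond_exp_mx_eq (sigma_of (x s)) (us s) u,
      exists C, forall s,
        cond_exp_le (sigma_of (x s)) (fun w => mxnorm2 (Ps s w) ^+ 2) C
    & exists C, forall s,
        cond_exp_le (sigma_of (x s)) (fun w => norm2 (us s w) ^+ 2) C].

Definition ms_convergent {n : nat} (x : nat -> T -> 'cV[R]_n) : Prop :=
  exists X : T -> 'cV[R]_n,
    [/\ random_mx X,
        ('E_Pr[fun w => (norm2 (X w) ^+ 2)%R] < +oo)%E
      & 'E_Pr[fun w => (norm2 (x s w - X w) ^+ 2)%R]%E @[s --> \oo] --> 0%E].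

End Random.

Section System.
Context {T : Type} {R : realType} {n : nat}.

Fixpoint state (Ps : nat -> T -> 'M[R]_n) (us : nat -> T -> 'cV[R]_n)
    (a : nat -> R) (x0 : 'cV[R]_n) (s : nat) (w : T) : 'cV[R]_n :=
  if s is r.+1 then
    let xr := state Ps us a x0 r w in
    (1 - a r) *: xr + a r *: (Ps r w *m xr + us r w)
  else x0.

(* (A1) constrains P(s) and u(s) only conditionally on x(s), so these may depend
   on the state, hence on the run of the system.  An environment therefore
   assigns to each initial state x0 and gain sequence a the random sequences
   P(s) and u(s) met along that run; random sequences P(s), u(s) given once and
   for all are the environments that ignore x0 and a. *)
Definition environment (E : Type) : Type :=
  'cV[R]_n -> (nat -> R) -> nat -> T -> E.

Definition run (Ps : environment 'M[R]_n) (us : environment 'cV[R]_n)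
    (x0 : 'cV[R]_n) (a : nat -> R) : nat -> T -> 'cV[R]_n :=
  state (Ps x0 a) (us x0 a) a x0.

End System.

Arguments environment T R n E : clear implicits.

(* Main.v *)
(** Only the means m(s) = E[x(s)] matter.  Conditioning on x(s) gives
    E[P(s) x(s)] = P E[x(s)], hence m(s+1) = m(s) + a(s) (Q m(s) + u) with
    Q = P - 1, and mean-square convergence forces m(s) --> l.  Since the gains
    sum to infinity, the drift must vanish at the limit: Q l + u = 0.  If
    xi Q = 0 and xi u <> 0 this is impossible.  Otherwise there is a row eta for
    which zeta = eta Q is a nonzero left eigenvector of Q whose eigenvalue has
    nonnegative real part (eta is an eigenvector of P, or a generalized one when
    the multiplicities of 1 differ); then |zeta (m(s) - l)| is nondecreasing and
    tends to 0, so zeta x(0) = zeta l = - eta u, which fails for a suitable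
    x(0) chosen before the gains.  Part ii) is part i) for (- a, - Q, - u). *)

Require Import Defs.
From mathcomp Require Import all_boot all_order all_algebra.
From mathcomp Require Import all_classical all_reals all_analysis.
From mathcomp Require Import complex ring lra.
From mathcomp Require Import measurable_realfun.

Set Implicit Arguments.
Unset Strict Implicit.
Unset Printing Implicit Defensive.

Import Order.TTheory GRing.Theory Num.Theory.
Import numFieldNormedType.Exports.
Local Open Scope classical_set_scope.
Local Open Scope ring_scope.

(** * Multiplicities *)

(** Both sides come from the block matrix [M]: clearing its upper right block by row operations
    leaves [y - C D], by column operations [y - D C]. The column multiplier has determinant
    [y ^+ r], so nothing is divided by [y] and [y] may be a polynomial. *)
Lemma det_scalar_sub_mulmxC (K : comNzRingType) (n r : nat)
    (C : 'M[K]_(n, r)) (D : 'M[K]_(r, n)) (y : K) :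
  \det (y%:M - C *m D) * y ^+ r = y ^+ n * \det (y%:M - D *m C).
Proof.
pose M := block_mx (y%:M : 'M[K]_n) C D (1%:M : 'M[K]_r).
have -> : \det (y%:M - C *m D) = \det M.
  have : \det (block_mx 1%:M (- C) 0 1%:M *m M) = \det M.
    by rewrite det_mulmx det_ublock !det1 !mul1r.
  rewrite mulmx_block !mul1mx !mul0mx !mulmx1 !add0r mulNmx subrr.
  by rewrite det_lblock det1 mulr1.
have : \det (M *m block_mx 1%:M (- C) 0 y%:M) = \det M * y ^+ r.
  by rewrite det_mulmx det_ublock det1 mul1r det_scalar.
rewrite mulmx_block !mulmx1 !mulmx0 !addr0 mul1mx mulmxN mul_scalar_mx.
rewrite mul_mx_scalar addNr.
by rewrite det_lblock det_scalar mulmxN addrC => ->.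
Qed.

Lemma mup_char_poly_eigenspace (K : fieldType) (n : nat) (A : 'M[K]_n) (l : K) :
  (forall v : 'rV[K]_n, v *m (A - l%:M) *m (A - l%:M) = 0 -> v *m (A - l%:M) = 0) ->
  mup l (char_poly A) = \rank (eigenspace A l).
Proof.
(* Write N = C D with D C of size rank N: then det (y - N) y^r = y^n det (y - D C),
   and D C is invertible because N and N^2 have the same kernel. *)
set N := A - l%:M => kerN.
have [r [rN [C [D [NE fullC freeD]]]]] : exists r : nat, r = \rank N /\
    exists (C : 'M[K]_(n, r)) (D : 'M[K]_(r, n)), [/\ C *m D = N, row_full C & row_free D].
  exists (\rank N); split=> //; exists (col_base N), (row_base N).
  by rewrite mulmx_base col_base_full row_base_free.
pose Y : {poly K} := 'X - l%:P.
have charE : char_poly A = \det (Y%:M - map_mx polyC C *m map_mx polyC D).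
  rewrite /char_poly /char_poly_mx -map_mxM NE /N map_mxB map_scalar_mx /=.
  by rewrite /Y raddfB/= opprB addrA subrK.
(* If [v D C = 0] and [v = w C], then [w N N = 0], hence [w N = v D = 0], and [D] is free. *)
have DCunit : D *m C \in unitmx.
  rewrite -row_free_unit -kermx_eq0; apply/rowV0P => v /sub_kermxP vDC.
  have [w wC] : exists w, w *m C = v.
    by exists (v *m pinvmx C); rewrite mulmxKpV// submx_full.
  have : w *m N = 0.
    by apply: kerN; rewrite -NE !mulmxA wC -(mulmxA v) vDC mul0mx.
  rewrite -NE mulmxA wC => vD.
  by apply/eqP; rewrite -(mulmx_free_eq0 v freeD) vD.
pose q : {poly K} := \det (Y%:M - map_mx polyC D *m map_mx polyC C).
have qE : char_poly A * Y ^+ r = Y ^+ n * q.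
  by rewrite charE det_scalar_sub_mulmxC.
have q_root : ~~ root q l.
  rewrite rootE /q -horner_evalE -det_map_mx map_mxB map_scalar_mx -map_mxM /=.
  rewrite /horner_eval hornerXsubC subrr.
  rewrite (_ : map_mx _ _ = D *m C); last by apply/matrixP => i j; rewrite !mxE hornerC.
  rewrite raddf0 sub0r -scaleN1r detZ mulf_eq0 negb_or signr_eq0.
  by rewrite -unitfE -unitmxE.
have Yn k : mup l (Y ^+ k) = k by rewrite mup_XsubCX eqxx.
have Y0 k : Y ^+ k != 0 by rewrite expf_neq0// polyXsubC_eq0.
(* Multiplicities of [l] on both sides of [qE]; [q] contributes none. *)
have E : (mup l (char_poly A) + r)%N = n.
  by rewrite -[r in LHS]Yn -mupM ?qE ?mupMl ?Yn// monic_neq0 ?char_poly_monic//.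
by rewrite /eigenspace mxrank_ker -rN -[X in (X - _)%N]E addnK.
Qed.

(** The row [v] starts a Jordan chain of length two; it will serve as [eta] with eigenvalue 0. *)
Lemma mup_char_poly_neq_rank (K : fieldType) (n : nat) (A : 'M[K]_n) (l : K) :
  mup l (char_poly A) <> \rank (eigenspace A l) ->
  exists v : 'rV[K]_n, v *m (A - l%:M) != 0 /\ v *m (A - l%:M) *m (A - l%:M) = 0.
Proof.
move=> neq; have /existsNP[v /not_implyP[vNN vN]] :
    ~ forall v : 'rV[K]_n, v *m (A - l%:M) *m (A - l%:M) = 0 -> v *m (A - l%:M) = 0.
  by move=> /mup_char_poly_eigenspace.
by exists v; split => //; apply/eqP.
Qed.

(** * The recursion of the means *)

(** If [rho > 0], the increments are eventually at least [a s * (rho / 2)], and the divergent sum of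
    the gains carries [y] to infinity. *)
Lemma cvg_drift_le0 (R : realType) (a y r : nat -> R) (l rho : R) :
  (forall s, 0 <= a s) -> series a @ \oo --> +oo ->
  (forall s, y s.+1 = y s + a s * r s) ->
  y @ \oo --> l -> r @ \oo --> rho -> rho <= 0.
Proof.
move=> a0 suma yS yl rrho; rewrite leNgt; apply/negP => rho0.
have rho2 : rho / 2 < rho by lra.
have [N _ rN] := cvgr_ge _ rrho _ rho2.
have growth k : rho / 2 * (series a (N + k)%N - series a N) <= y (N + k)%N - y N.
  elim: k => [|k IHk]; first by rewrite addn0 !subrr mulr0.
  rewrite addnS yS seriesSr; have := rN (N + k)%N (leq_addr _ _).
  move=> /(ler_wpM2l (a0 (N + k)%N)) /=; nra.
have [M1 _ yM] := cvgr_le _ yl _ (ltr_pwDr ltr01 (lexx l)).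
(* Gains beyond this threshold, times [rho / 2], lift [y] from [y N] above [l + 1], which bounds [y]
   from [M1] on. *)
have /cvgryPgt/(_ (series a N + (l + 1 - y N) / (rho / 2))) [M2 _ aM] := suma.
pose k := maxn M1 M2.
have /= := yM (N + k)%N (leq_trans (leq_maxl _ _) (leq_addl _ _)).
have /= := aM (N + k)%N (leq_trans (leq_maxr _ _) (leq_addl _ _)).
rewrite -ltrBrDl ltr_pdivrMr; last by lra.
have := growth k; lra.
Qed.

Lemma cvg_drift_eq0 (R : realType) (a y r : nat -> R) (l rho : R) :
  (forall s, 0 <= a s) -> series a @ \oo --> +oo ->
  (forall s, y s.+1 = y s + a s * r s) ->
  y @ \oo --> l -> r @ \oo --> rho -> rho = 0.
Proof.
move=> a0 suma yS yl rrho; apply/eqP; rewrite eq_le (cvg_drift_le0 a0 suma yS yl rrho).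
rewrite -oppr_le0 (cvg_drift_le0 (y := fun s => - y s) (r := fun s => - r s) (l := - l) a0 suma)//.
- by move=> s; rewrite yS mulrN opprD.
- exact: cvgN.
- exact: cvgN.
Qed.

Lemma cvg_mulmx_entry (R : realType) (p n : nat) (A : 'M[R]_(p, n))
    (m : nat -> 'cV[R]_n) (l : 'cV[R]_n) (i : 'I_p) :
  (forall j, m s j 0 @[s --> \oo] --> l j 0) ->
  (A *m m s) i 0 @[s --> \oo] --> (A *m l) i 0.
Proof.
move=> ml; under eq_fun do rewrite mxE; rewrite mxE.
apply: cvg_big => [|j _]; last by apply: cvgMr; exact: ml.
exact: add_continuous.
Qed.

(** Together with its analogue for [Im], this splits a complex functional into two real ones, so
    that limits are taken in [R] only. *)
Lemma Re_mul_cmx (R : realType) (n : nat) (z : 'rV[R[i]]_n) (v : 'cV[R]_n) :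
  complex.Re ((z *m cmx v) 0 0) = (map_mx (@complex.Re R) z *m v) 0 0.
Proof.
rewrite !mxE; elim/big_ind2: _ => //= [? [x1 y1] ? [x2 y2] <- <-//|j _].
by rewrite !mxE; case: (z 0 j) => x y /=; rewrite mulr0 subr0.
Qed.

Lemma Im_mul_cmx (R : realType) (n : nat) (z : 'rV[R[i]]_n) (v : 'cV[R]_n) :
  complex.Im ((z *m cmx v) 0 0) = (map_mx (@complex.Im R) z *m v) 0 0.
Proof.
rewrite !mxE; elim/big_ind2: _ => //= [? [x1 y1] ? [x2 y2] <- <-//|j _].
by rewrite !mxE; case: (z 0 j) => x y /=; rewrite mulr0 add0r.
Qed.

(** Each step multiplies [z e(s)] by [1 + a(s) mu], of modulus at least 1 because [a(s)] and the
    real part of [mu] are nonnegative. A nondecreasing modulus with limit 0 vanishes from the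
    start. *)
Lemma left_eigen_decay_eq0 (R : realType) (n : nat) (Q : 'M[R]_n)
    (z : 'rV[R[i]]_n) (mu : R[i]) (a : nat -> R) (e : nat -> 'cV[R]_n) :
  z *m cmx Q = mu *: z -> 0 <= complex.Re mu -> (forall s, 0 <= a s) ->
  (forall s, e s.+1 = e s + a s *: (Q *m e s)) ->
  (forall i, e s i 0 @[s --> \oo] --> (0 : R)) ->
  z *m cmx (e 0) = 0.
Proof.
move=> zQ mu0 a0 eS e0.
pose f s := (z *m cmx (e s)) 0 0.
pose N s := complex.Re (f s) ^+ 2 + complex.Im (f s) ^+ 2.
have fS s : f s.+1 = (1 + (a s)%:C%C * mu) * f s.
  rewrite /f eS /cmx map_mxD map_mxZ map_mxM -!/(cmx _) mulmxDr -scalemxAr.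
  by rewrite mulmxA zQ -scalemxAl !mxE mulrDl mul1r mulrA.
have Nle s : N 0 <= N s.
  elim: s => // s IHs; apply: le_trans IHs _; rewrite /N fS.
  case: (f s) => p q; case: mu mu0 {zQ fS} => al be /= al0; rewrite !mul0r !subr0 !add0r !addr0.
  have ax0 : 0 <= a s * al by rewrite mulr_ge0.
  (* Multiplicativity of the squared modulus, with [mu = al + i be]. *)
  rewrite [leRHS](_ : _ =
    ((1 + a s * al) ^+ 2 + (a s * be) ^+ 2) * (p ^+ 2 + q ^+ 2)); last by ring.
  rewrite -[leLHS]mul1r ler_wpM2r ?addr_ge0 ?sqr_ge0//.
  by have := sqr_ge0 (a s * be); nra.
have N0 : N s @[s --> \oo] --> (0 : R).
  have fcvg (g : 'rV[R]_n) : (g *m e s) 0 0 @[s --> \oo] --> (0 : R).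
    have := @cvg_mulmx_entry R 1 n g e 0 0; rewrite mulmx0 mxE; apply=> j.
    by rewrite mxE.
  rewrite /N /f; under eq_fun do rewrite Re_mul_cmx Im_mul_cmx !expr2.
  pose gr := fcvg (map_mx (@complex.Re R) z); pose gi := fcvg (map_mx (@complex.Im R) z).
  by have := cvgD (cvgM gr gr) (cvgM gi gi); rewrite mulr0 addr0; apply.
have : N 0%N <= 0.
  rewrite -(cvg_lim _ N0)//; apply: limr_ge; first by apply/cvg_ex; exists 0.
  by near=> s; exact: Nle.
rewrite /N; case E: (f 0%N) => [p q] /= pq0.
apply/matrixP => i j; rewrite !ord1 -/(f 0%N) E mxE.
move: pq0; rewrite le_eqVlt ltNge addr_ge0 ?sqr_ge0// orbF.
by rewrite paddr_eq0 ?sqr_ge0// !sqrf_eq0 => /andP[/eqP -> /eqP ->].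
Unshelve. all: end_near. Qed.

(** The first case keeps [eta] beside the eigenvector [eta Q], because at an equilibrium [l] the
    value [eta Q l] is [- eta v], whatever the gains. In the second case there is no equilibrium at
    all. *)
Definition obstruction (R : realType) (n : nat) (Q : 'M[R]_n) (v : 'cV[R]_n) : Prop :=
  (exists (eta : 'rV[R[i]]_n) (mu : R[i]),
     [/\ eta *m cmx Q != 0, 0 <= complex.Re mu
       & eta *m cmx Q *m cmx Q = mu *: (eta *m cmx Q)]) \/
  (exists2 xi : 'rV[R[i]]_n, xi *m cmx Q = 0 & xi *m cmx v != 0).

(** A nonzero complex functional takes two values on real vectors: 0 at the origin and a nonzero
    entry of [z] at a basis vector. *)
Lemma mul_cmx_avoid (R : realType) (n : nat) (z : 'rV[R[i]]_n) (c : 'M[R[i]]_1) :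
  z != 0 -> exists x0 : 'cV[R]_n, z *m cmx x0 <> c.
Proof.
move=> z0; have [->|c0] := eqVneq c 0; last first.
  by exists 0; rewrite /cmx map_mx0 mulmx0 => /esym/eqP; exact/negP.
have [j zj] : exists j, z 0 j != 0.
  apply/existsP; rewrite -negb_forall; apply: contra z0 => /forallP z0.
  by apply/eqP/rowP => j; rewrite mxE; apply/eqP/z0.
exists (delta_mx j 0); rewrite /cmx map_delta_mx => /matrixP/(_ 0 0).
by rewrite -colE !mxE; apply/eqP.
Qed.

Lemma obstruction_diverges (R : realType) (n : nat) (Q : 'M[R]_n) (v : 'cV[R]_n) :
  obstruction Q v ->
  exists x0 : 'cV[R]_n, forall (a : nat -> R) (m : nat -> 'cV[R]_n) (l : 'cV[R]_n),
    (forall s, 0 <= a s) -> series a @ \oo --> +oo ->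
    m 0 = x0 -> (forall s, m s.+1 = m s + a s *: (Q *m m s + v)) ->
    ~ (forall i, m s i 0 @[s --> \oo] --> l i 0).
Proof.
have equilibrium a m (l : 'cV[R]_n) : (forall s, 0 <= a s) -> series a @ \oo --> +oo ->
    (forall s, m s.+1 = m s + a s *: (Q *m m s + v)) ->
    (forall i, m s i 0 @[s --> \oo] --> l i 0) -> Q *m l + v = 0.
  move=> a0 suma mS ml; apply/colP => i; rewrite [RHS]mxE.
  apply: (cvg_drift_eq0 (y := fun s => m s i 0) (r := fun s => (Q *m m s + v) i 0)
    a0 suma _ (ml i)).
  - by move=> s; rewrite mS !mxE.
  - under eq_fun do rewrite mxE; rewrite mxE.
    by apply: cvgD; [exact: cvg_mulmx_entry|exact: cvg_cst].
have cmx_equilibrium (w : 'rV_n) (l : 'cV[R]_n) :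
    Q *m l + v = 0 -> w *m cmx Q *m cmx l = - (w *m cmx v).
  move=> /(congr1 cmx)/(congr1 (mulmx w)); rewrite /cmx map_mx0 map_mxD map_mxM mulmx0.
  by rewrite mulmxDr mulmxA => /eqP; rewrite addr_eq0 => /eqP.
move=> [[eta [mu [z0 mu0 zQ]]]|[xi xiQ xiv]]; last first.
  exists 0 => a m l a0 suma _ mS ml.
  have := cmx_equilibrium xi l (equilibrium a m l a0 suma mS ml).
  by rewrite xiQ mul0mx => /esym/eqP; rewrite oppr_eq0; exact/negP.
(* Convergence would force [eta Q x0 = eta Q l = - eta v]; [x0] is chosen to miss this value, before
   any gains are given. *)
have [x0 x0P] := mul_cmx_avoid (- (eta *m cmx v)) z0.
exists x0 => a m l a0 suma m0 mS ml; apply: x0P.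
have lP := equilibrium a m l a0 suma mS ml.
rewrite -(cmx_equilibrium eta l lP) -m0; apply/eqP; rewrite -subr_eq0 -mulmxBr -map_mxB.
(* Since [v = - Q l], the deviation [m - l] obeys the homogeneous recursion. *)
apply/eqP; apply: (left_eigen_decay_eq0 (e := fun s => m s - l) zQ mu0 a0) => [s|i].
  by rewrite mS addrAC mulmxBr; congr (_ + _ *: (_ + _)); apply/eqP; rewrite -addr_eq0 addrC lP.
under eq_fun do rewrite !mxE.
by have := cvgB (ml i) (cvg_cst (l i 0)); rewrite subrr; apply.
Qed.

(** * Obstructions read off the spectrum of [P] *)

Section ObstructionOfSpectrum.
Variables (R : realType) (n : nat) (P : 'M[R]_n) (u : 'cV[R]_n) (c : R).
Hypothesis c0 : c != 0.
(** The scalar [c] is 1 for part i) and -1 for part ii). *)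
Let Q := c *: (P - 1%:M).

Let cmxQ : cmx Q = c%:C%C *: (cmx P - 1%:M).
Proof. by rewrite /cmx map_mxZ map_mxB map_mx1. Qed.

Let c0C : c%:C%C != 0 :> R[i].
Proof. by rewrite fmorph_eq0. Qed.

Lemma obstruction_eigenvalue (l : R[i]) :
  eigenvalue (cmx P) l -> l != 1 -> 0 <= c * (complex.Re l - 1) ->
  obstruction Q (c *: u).
Proof.
move=> /eigenvalueP[xi xiP xi0] l1 Rel; left.
have xiQ : xi *m cmx Q = (c%:C%C * (l - 1)) *: xi.
  by rewrite cmxQ -scalemxAr mulmxBr xiP mulmx1 -scalerA scalerBl scale1r.
exists xi, (c%:C%C * (l - 1)); split.
- by rewrite xiQ scaler_eq0 negb_or xi0 mulf_neq0// subr_eq0.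
- by move: Rel; case: (l) => x y /=; rewrite !mul0r subr0.
- by rewrite {1}xiQ -scalemxAl.
Qed.

(** Each clause of [A3] fails with its own obstruction: an eigenvalue [l != 1] of real part 1, a
    Jordan chain at 1, or a left eigenvector at 1 that does not annihilate [u]. *)
Lemma obstruction_not_A3 : ~ A3 P u -> obstruction Q (c *: u).
Proof.
move=> nA3; apply: contrapT => nobs; apply: nA3; split.
- move=> l el Rel; apply: contrapT => /eqP l1; apply: nobs.
  by apply: (obstruction_eigenvalue el l1); rewrite Rel subrr mulr0.
- apply: contrapT => /mup_char_poly_neq_rank[v [vN vNN]]; apply: nobs.
  left; exists v, 0; rewrite cmxQ -scalemxAr; split=> //.
    by rewrite scaler_eq0 negb_or c0C.
  by rewrite -scalemxAr -scalemxAl vNN !scaler0 scale0r.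
- move=> xi _ xiP; apply: contrapT => /eqP xiu; apply: nobs; right.
  exists xi; first by rewrite cmxQ -scalemxAr mulmxBr xiP mulmx1 subrr scaler0.
  by rewrite /cmx map_mxZ -scalemxAr scaler_eq0 negb_or c0C.
Qed.

End ObstructionOfSpectrum.

Lemma eigen_Re_nonempty (R : realType) (n : nat) (P : 'M[R]_n) :
  (0 < n)%N -> eigen_Re P !=set0.
Proof. by move=> /(eigenvalue_closed (cmx P))[l el]; exists (complex.Re l), l. Qed.

(** Without an obstruction 1 bounds the real parts of all eigenvalues, hence their supremum. *)
Lemma obstruction_rho_max (R : realType) (n : nat) (P : 'M[R]_n) (u : 'cV[R]_n) :
  (0 < n)%N -> rho_max P > 1 \/ (rho_max P = 1 /\ ~ A3 P u) ->
  obstruction (P - 1%:M) u.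
Proof.
move=> n0 H; rewrite -[P - _]scale1r -[u]scale1r.
case: H => [rho1|[_]]; last exact: obstruction_not_A3 (oner_neq0 _).
apply: contrapT => nobs; move: rho1; rewrite ltNge => /negP; apply.
apply: ge_sup; first exact: eigen_Re_nonempty.
move=> _ [l el <-]; rewrite leNgt; apply/negP => Rel; apply: nobs.
apply: (obstruction_eigenvalue _ (oner_neq0 _) el); last by rewrite mul1r subr_ge0 ltW.
by apply: contraTneq Rel => ->; rewrite ltxx.
Qed.

Lemma obstruction_rho_min (R : realType) (n : nat) (P : 'M[R]_n) (u : 'cV[R]_n) :
  (0 < n)%N -> rho_min P < 1 \/ (rho_min P = 1 /\ ~ A3 P u) ->
  obstruction (- (P - 1%:M)) (- u).
Proof.
move=> n0 H; rewrite -[- (P - _)]scaleN1r -[- u]scaleN1r.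
have N10 : -1 != 0 :> R by rewrite oppr_eq0 oner_neq0.
case: H => [rho1|[_]]; last exact: obstruction_not_A3.
apply: contrapT => nobs; move: rho1; rewrite ltNge => /negP; apply.
apply: lb_le_inf; first exact: eigen_Re_nonempty.
move=> _ [l el <-]; rewrite leNgt; apply/negP => Rel; apply: nobs.
apply: (obstruction_eigenvalue _ N10 el); last by rewrite mulN1r oppr_ge0 subr_le0 ltW.
by apply: contraTneq Rel => ->; rewrite ltxx.
Qed.

(** * Conditional expectations *)

Section IntegralCompMul.
Context d (T : measurableType d) (R : realType) (mu : {measure set T -> \bar R}).
Local Open Scope ereal_scope.
Import HBNNSimple.

Let integral_nnsfun_comp_mul (f g : T -> R) (h : {nnsfun R >-> R}) :
  measurable_fun setT f -> measurable_fun setT g -> (forall x, 0 <= g x)%R ->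
  \int[mu]_x (h (f x) * g x)%:E =
  \sum_(r \in range h) r%:E * \int[mu]_(x in f @^-1` (h @^-1` [set r])) (g x)%:E.
Proof.
move=> mf mg g0.
have mfr r : measurable (f @^-1` (h @^-1` [set r])).
  by rewrite -[X in measurable X]setTI; apply: mf.
have hE x : (h (f x) * g x)%:E = \sum_(r \in range h)
    (r%:E * (\1_(f @^-1` (h @^-1` [set r])) x * g x)%:E).
  rewrite fimfunE EFinM -fsumEFin//.
  rewrite ge0_mule_fsuml => [|r]; last exact: nnfun_muleindic_ge0.
  by apply: eq_fsbigr => r _; rewrite !EFinM muleA.
under eq_integral do rewrite hE.
have mind r : measurable_fun setT (fun x => (\1_(f @^-1` (h @^-1` [set r])) x * g x)%:E).
  by apply/measurable_EFinP; apply: measurable_funM => //; exact: measurable_indic.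
rewrite ge0_integral_fsum//; last 2 first.
- by move=> r; exact: measurable_funeM.
- move=> r x _; rewrite EFinM muleA mule_ge0 ?lee_fin//.
  exact: (nnfun_muleindic_ge0 h r (f x)).
apply: eq_fsbigr => r /set_mem[y _ <-].
rewrite ge0_integralZl ?lee_fin//; last first.
  by move=> x _; rewrite lee_fin mulr_ge0.
rewrite [in RHS]integral_mkcond; congr (_ * _); apply: eq_integral => x _.
by rewrite epatch_indic /= -EFinM mulrC.
Qed.

(** A comparison on the events of [f] extends to weights [h (f x)]: by linearity for simple [h],
    then by monotone convergence. *)
Lemma ge0_le_integral_comp_mul (f g1 g2 : T -> R) (h : R -> R) :
  measurable_fun setT f -> measurable_fun setT g1 -> measurable_fun setT g2 ->
  measurable_fun setT h ->
  (forall x, 0 <= g1 x)%R -> (forall x, 0 <= g2 x)%R -> (forall y, 0 <= h y)%R ->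
  (forall B, measurable B ->
     \int[mu]_(x in f @^-1` B) (g1 x)%:E <= \int[mu]_(x in f @^-1` B) (g2 x)%:E) ->
  \int[mu]_x (h (f x) * g1 x)%:E <= \int[mu]_x (h (f x) * g2 x)%:E.
Proof.
move=> mf mg1 mg2 mh g10 g20 h0 leg.
have mEh : measurable_fun setT (EFin \o h) by exact/measurable_EFinP.
pose hn := nnsfun_approx measurableT mEh.
have step (g : T -> R) : measurable_fun setT g -> (forall x, 0 <= g x)%R ->
    \int[mu]_x (hn n (f x) * g x)%:E @[n --> \oo] --> \int[mu]_x (h (f x) * g x)%:E.
  move=> mg g0.
  have -> : \int[mu]_x (h (f x) * g x)%:E =
     \int[mu]_x (limn (fun n => (hn n (f x) * g x)%:E)).
    apply: eq_integral => x _; apply/esym/cvg_lim => //.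
    rewrite EFinM; under eq_fun do rewrite EFinM.
    apply: cvgeZr => //.
    by apply: (cvg_nnsfun_approx measurableT mEh) => // y _; rewrite lee_fin.
  apply: cvg_monotone_convergence => //.
  - move=> n; apply/measurable_EFinP; apply: measurable_funM => //.
    exact: measurableT_comp.
  - by move=> n x _; rewrite lee_fin mulr_ge0.
  - move=> x _ p q pq; rewrite lee_fin ler_wpM2r//.
    exact/lefP/nd_nnsfun_approx.
apply: lee_cvg_to (step _ mg1 g10) (step _ mg2 g20) _.
apply: nearW => n; rewrite !integral_nnsfun_comp_mul//.
apply: lee_fsum => // r [y _ <-].
by apply: lee_wpmul2l; [rewrite lee_fin|exact: leg].
Qed.

End IntegralCompMul.

Section PullOut.
Context d (T : measurableType d) (R : realType) (Pr : probability T R).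
(** The hypotheses say that, given [f], the mean of [p] is [c] and that of its absolute value is at
    most [C]. The bound [C] makes [p * f] integrable, which integrability of both factors alone
    would not. *)
Variables (f p : T -> R) (c C : R).
Hypothesis mf : measurable_fun setT f.
Hypothesis intp : Pr.-integrable setT (EFin \o p).
Hypothesis pc : forall B : set R, measurable B ->
  (\int[Pr]_(x in f @^-1` B) c%:E = \int[Pr]_(x in f @^-1` B) (p x)%:E)%E.
Hypothesis pC : forall B : set R, measurable B ->
  (\int[Pr]_(x in f @^-1` B) `|p x|%:E <= \int[Pr]_(x in f @^-1` B) C%:E)%E.

Let mp : measurable_fun setT p.
Proof. by apply/measurable_EFinP; exact: measurable_int intp. Qed.

Let integrable_normp : Pr.-integrable setT (EFin \o (fun x => `|p x|)).
Proof. exact: integrable_abse intp. Qed.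

Let integrable_cst_Pr (k : R) : Pr.-integrable setT (EFin \o (fun=> k)).
Proof. exact: finite_measure_integrable_cst. Qed.

Let ge0_pull_out (h : R -> R) : measurable_fun setT h -> (forall y, 0 <= h y) ->
  Pr.-integrable setT (EFin \o (h \o f)) ->
  Pr.-integrable setT (EFin \o (fun x => h (f x) * p x)) /\
  \int[Pr]_x (h (f x) * p x) = c * \int[Pr]_x h (f x).
Proof.
move=> mh h0 inth.
have mhf : measurable_fun setT (fun x => h (f x)) by exact: measurableT_comp.
have inthk k : Pr.-integrable setT (EFin \o (fun x => h (f x) * k)).
  exact: integrableZr inth.
(* The bound [pC] tested on the whole space, of probability 1. *)
have C0 : 0 <= C.
  have := pC measurableT; rewrite preimage_setT.
  rewrite [leRHS]integral_cst// [X in (_ * X)%E]probability_setT mule1.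
  by rewrite -lee_fin; apply: le_trans; apply: integral_ge0 => x _; rewrite lee_fin.
have inthnp : Pr.-integrable setT (EFin \o (fun x => h (f x) * `|p x|)).
  apply/integrableP; split.
    apply/measurable_EFinP/measurable_funM => //; exact: measurableT_comp.
  under eq_integral do rewrite /= ger0_norm ?mulr_ge0//.
  apply: (@le_lt_trans _ _ (\int[Pr]_x (h (f x) * C)%:E)%E).
    apply: ge0_le_integral_comp_mul => //.
    exact: measurableT_comp.
  exact: integrable_lty (inthk C).
have inthp : Pr.-integrable setT (EFin \o (fun x => h (f x) * p x)).
  apply: le_integrable inthnp => //.
    by apply/measurable_EFinP; exact: measurable_funM.
  by move=> x _ /=; rewrite !normrM normr_id.
split=> //.
(* Adding G makes both p and c nonnegative, as [ge0_le_integral_comp_mul] requires. *)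
pose G x := `|p x| + `|c|.
have intG : Pr.-integrable setT (EFin \o G).
  exact: (integrableD measurableT integrable_normp (integrable_cst_Pr `|c|)).
have inthG : Pr.-integrable setT (EFin \o (fun x => h (f x) * G x)).
  have := integrableD measurableT inthnp (inthk `|c|).
  by apply: eq_integrable => // x _; rewrite /= /G mulrDr.
have mG : measurable_fun setT G by apply/measurable_EFinP; exact: measurable_int intG.
have eqG B : measurable B ->
    (\int[Pr]_(x in f @^-1` B) (c + G x)%:E = \int[Pr]_(x in f @^-1` B) (p x + G x)%:E)%E.
  move=> mB.
  have mfB : measurable (f @^-1` B) by rewrite -[X in measurable X]setTI; apply: mf.
  have iS g : Pr.-integrable setT g -> Pr.-integrable (f @^-1` B) g by exact: integrableS.
  have := integralD_EFin mfB (iS _ (integrable_cst_Pr c)) (iS _ intG).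
  have := integralD_EFin mfB (iS _ intp) (iS _ intG).
  by move=> /= -> ->; rewrite pc.
have E : \int[Pr]_x (h (f x) * (c + G x)) = \int[Pr]_x (h (f x) * (p x + G x)).
  congr fine; apply/eqP; rewrite eq_le.
  have g10 x : 0 <= c + G x.
    by rewrite /G; have := ler_norm (- c); rewrite normrN; have := normr_ge0 (p x); lra.
  have g20 x : 0 <= p x + G x.
    by rewrite /G; have := ler_norm (- p x); rewrite normrN; have := normr_ge0 c; lra.
  by apply/andP; split; apply: ge0_le_integral_comp_mul => //;
    (try by apply: measurable_funD) => B mB; rewrite eqG.
have Dh (g : T -> R) : Pr.-integrable setT (EFin \o (fun x => h (f x) * g x)) ->
    \int[Pr]_x (h (f x) * (g x + G x)) =
    \int[Pr]_x (h (f x) * g x) + \int[Pr]_x (h (f x) * G x).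
  move=> ig; rewrite -RintegralD//; apply: eq_Rintegral => x _; exact: mulrDr.
(* The common real term with [G] cancels. *)
move: E; rewrite Dh// Dh// => /addIr <-.
by rewrite RintegralZr// mulrC.
Qed.

Let pull_out : Pr.-integrable setT (EFin \o f) ->
  Pr.-integrable setT (EFin \o (fun x => p x * f x)) /\
  \int[Pr]_x (p x * f x) = c * \int[Pr]_x f x.
Proof.
move=> intf.
have intfp : Pr.-integrable setT (EFin \o f^\+) by exact: integrable_funrpos.
have intfn : Pr.-integrable setT (EFin \o f^\-) by exact: integrable_funrneg.
have mid : measurable_fun setT (@idfun R) by exact: measurable_id.
(* The parts of the identity, composed with [f], are the parts of [f]. *)
have [|y|//|ip Ep] := @ge0_pull_out (@idfun R)^\+.
- exact: measurable_funrpos.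
- exact: funrpos_ge0.
have [|y|//|iN En] := @ge0_pull_out (@idfun R)^\-.
- exact: measurable_funrneg.
- exact: funrneg_ge0.
have fB x : f x = f^\+ x - f^\- x by rewrite -[in LHS](funrposBneg f).
have fE x : p x * f x = f^\+ x * p x - f^\- x * p x.
  by rewrite mulrC -mulrBl -fB.
split.
  by have := integrableB measurableT ip iN; apply: eq_integrable => // x _; rewrite /= fE.
rewrite (eq_Rintegral _ (fun x _ => fE x)) RintegralB//.
transitivity (c * \int[Pr]_x f^\+ x - c * \int[Pr]_x f^\- x); first by rewrite -Ep -En.
by rewrite -mulrBr -RintegralB//; congr (_ * _); apply: eq_Rintegral => x _; exact/esym/fB.
Qed.

Lemma integrable_pull_out : Pr.-integrable setT (EFin \o f) ->
  Pr.-integrable setT (EFin \o (fun x => p x * f x)).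
Proof. by case/pull_out. Qed.

Lemma Rintegral_pull_out : Pr.-integrable setT (EFin \o f) ->
  \int[Pr]_x (p x * f x) = c * \int[Pr]_x f x.
Proof. by case/pull_out. Qed.

End PullOut.

(** * Entries against norms, and events of the state *)

Section MatrixNorm.
Variables (R : realType) (n : nat).

Lemma entry_le_norm2 (v : 'cV[R]_n) (i : 'I_n) : `|v i 0| <= norm2 v.
Proof.
rewrite -sqrtr_sqr ler_wsqrtr// (bigD1 i)//= lerDl.
by apply: sumr_ge0 => j _; exact: sqr_ge0.
Qed.

Lemma norm2_le_sum (v : 'cV[R]_n) : norm2 v <= \sum_i `|v i 0|.
Proof.
have s0 : 0 <= \sum_i `|v i 0| by exact: sumr_ge0.
rewrite -(ger0_norm s0) -sqrtr_sqr ler_wsqrtr// expr2 mulr_suml; apply: ler_sum => i _.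
rewrite -real_normK ?num_real// expr2 ler_wpM2l// (bigD1 i)//= lerDl.
by exact: sumr_ge0.
Qed.

Lemma entry_le_mxnorm2 (A : 'M[R]_n) (i j : 'I_n) : `|A i j| <= mxnorm2 A.
Proof.
have norm2_delta : norm2 (delta_mx j 0 : 'cV[R]_n) <= 1.
  rewrite /norm2 (bigD1 j)//= big1 ?addr0 => [|k kj]; rewrite mxE ?eqxx ?(negbTE kj).
    by rewrite expr1n sqrtr1.
  by rewrite expr0n.
apply: (@le_trans _ _ (norm2 (A *m delta_mx j 0))).
  by apply: le_trans (entry_le_norm2 _ i); rewrite -colE mxE.
apply: ub_le_sup; last by exists (delta_mx j 0).
(* The supremum dominates its members only once the set is bounded above; the sum of all absolute
   entries is a crude bound. *)
exists (\sum_i \sum_j `|A i j|) => _ [v v1 <-].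
apply: le_trans (norm2_le_sum _) _; apply: ler_sum => k _; rewrite mxE.
apply: le_trans (ler_norm_sum _ _ _) _; apply: ler_sum => l _.
by rewrite normrM ler_piMr// (le_trans (entry_le_norm2 v l)).
Qed.

End MatrixNorm.

(** Events of a single coordinate suffice later, since [P(s) x(s)] is treated one product of entries
    at a time. *)
Lemma sigma_of_preimage (d : measure_display) (T : measurableType d)
    (R : realType) (n : nat) (X : T -> 'cV[R]_n)
    (k : 'I_n) (B : set R) :
  measurable B -> sigma_of X ((fun w => X w k 0) @^-1` B).
Proof.
move=> mB; apply: sub_sigma_algebra; rewrite (bigD1 k)//=; left.
by exists B => //; rewrite setTI.
Qed.

Lemma sigma_ofT (d : measure_display) (T : measurableType d)
    (R : realType) (n : nat) (X : T -> 'cV[R]_n) :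
  sigma_of X setT.
Proof. by rewrite -setC0; apply: sigma_algebraC; exact: sigma_algebra0. Qed.

(** Passing to the positive part of [Y] and to the absolute value of [C] makes both integrands
    nonnegative, as the almost-everywhere comparison requires. *)
Lemma cond_exp_le_integral (d : measure_display) (T : measurableType d) (R : realType)
    (Pr : probability T R) (G : set (set T)) (X : T -> R) (C : R) (A : set T) :
  cond_exp_le Pr G X C -> G A -> measurable A ->
  (\int[Pr]_(w in A) (X w)%:E <= \int[Pr]_(w in A) `|C|%:E)%E.
Proof.
move=> [Y [_ intY _ XY] YC] GA mA; rewrite -XY//.
have intYA : Pr.-integrable A (EFin \o Y) by apply: integrableS intY.
apply: (@le_trans _ _ (\int[Pr]_(w in A) (Y^\+ w)%:E)%E).
  apply: le_integral => //; first exact: integrable_funrpos.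
  by move=> w _; rewrite lee_fin le_max lexx.
apply: ae_ge0_le_integral => //.
- by move=> w _; rewrite lee_fin funrpos_ge0.
- exact: measurable_int (integrable_funrpos mA intYA).
- apply: filterS YC => w YC _.
  by rewrite lee_fin ge_max normr_ge0 (le_trans YC)// ler_norm.
Qed.

Lemma Rintegral_sum (d : measure_display) (T : measurableType d) (R : realType)
    (mu : {measure set T -> \bar R}) (I : Type) (s : seq I) (g : I -> T -> R) :
  (forall i, mu.-integrable setT (EFin \o g i)) ->
  \int[mu]_w (\sum_(i <- s) g i w) = \sum_(i <- s) \int[mu]_w g i w.
Proof.
move=> intg; elim: s => [|i s IHs].
  by rewrite big_nil; under eq_Rintegral do rewrite big_nil; rewrite Rintegral_cst ?mul0r.
rewrite big_cons -IHs -RintegralD//; last first.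
  have := integrable_sum measurableT s (fun i (_ : true) => intg i).
  by apply: eq_integrable => // w _; rewrite /= sumEFin.
by apply: eq_Rintegral => w _; rewrite big_cons.
Qed.

(** * The mean after one step of the system *)

Section ConditionalMean.
Context (d : measure_display) (T : measurableType d) (R : realType) (Pr : probability T R).
Variables (n : nat) (x u : T -> 'cV[R]_n) (A : T -> 'M[R]_n) (P : 'M[R]_n) (v : 'cV[R]_n) (C : R).
Hypothesis condA : cond_exp_mx_eq Pr (sigma_of x) A P.
Hypothesis condu : cond_exp_mx_eq Pr (sigma_of x) u v.
Hypothesis bndA : cond_exp_le Pr (sigma_of x) (fun w => mxnorm2 (A w) ^+ 2) C.
Hypothesis intx : forall i, Pr.-integrable setT (EFin \o (fun w => x w i 0)).

Let mx k : measurable_fun setT (fun w => x w k 0).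
Proof. by apply/measurable_EFinP; exact: measurable_int (intx k). Qed.

Let entry_pull_out i j k :
  Pr.-integrable setT (EFin \o (fun w => A w i j * x w k 0)) /\
  \int[Pr]_w (A w i j * x w k 0) = P i j * \int[Pr]_w x w k 0.
Proof.
have [intA _ _ PA] := condA i j.
have [Y [intN _ _ _] _] := bndA.
have pre (B : set R) : measurable B -> measurable ((fun w => x w k 0) @^-1` B).
  by move=> mB; rewrite -[X in measurable X]setTI; exact: mx.
(* The constant comes from bounding an absolute entry by 1 plus the squared norm of the matrix. *)
have PC (B : set R) : measurable B ->
    (\int[Pr]_(w in (fun w => x w k 0%R) @^-1` B) `|A w i j|%:E <=
     \int[Pr]_(w in (fun w => x w k 0%R) @^-1` B) (1 + `|C|)%:E)%E.
  move=> mB; have mS := pre _ mB; set S := _ @^-1` B.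
  have int1 (r : R) : Pr.-integrable S (EFin \o (fun=> r)).
    exact: finite_measure_integrable_cst.
  have intNS : Pr.-integrable S (EFin \o (fun w => mxnorm2 (A w) ^+ 2)).
    exact: integrableS intN.
  apply: (@le_trans _ _ (\int[Pr]_(w in S) (1 + mxnorm2 (A w) ^+ 2)%:E)%E).
    apply: le_integral => //.
    - exact: (integrable_norm (integrableS measurableT mS (@subsetT _ _) intA)).
    - exact: (integrableD mS (int1 1) intNS).
    - move=> w _; rewrite lee_fin.
      by have := entry_le_mxnorm2 (A w) i j; have := normr_ge0 (A w i j); nra.
  have := integralD_EFin mS (int1 1) intNS; have := integralD_EFin mS (int1 1) (int1 `|C|).
  move=> /= -> ->; apply: leeD => //.
  exact: (cond_exp_le_integral bndA (sigma_of_preimage k mB) mS).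
have PAx (B : set R) : measurable B ->
    (\int[Pr]_(w in (fun w => x w k 0%R) @^-1` B) (P i j)%:E =
     \int[Pr]_(w in (fun w => x w k 0%R) @^-1` B) (A w i j)%:E)%E.
  by move=> mB; apply: PA; exact: sigma_of_preimage.
split; first exact: (integrable_pull_out (mx k) intA PAx PC (intx k)).
exact: (Rintegral_pull_out (mx k) intA PAx PC (intx k)).
Qed.

Definition mean (z : T -> 'cV[R]_n) : 'cV[R]_n := \col_i \int[Pr]_w z w i 0.

Let intAx i : Pr.-integrable setT (EFin \o (fun w => (A w *m x w) i 0)).
Proof.
have := integrable_sum measurableT (index_enum 'I_n)
  (fun j (_ : true) => (entry_pull_out i j j).1).
by apply: eq_integrable => // w _; rewrite /= mxE sumEFin.
Qed.

Let mean_Ax i : \int[Pr]_w (A w *m x w) i 0 = (P *m mean x) i 0.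
Proof.
rewrite mxE; under eq_Rintegral do rewrite mxE.
rewrite Rintegral_sum => [|j]; last exact: (entry_pull_out i j j).1.
by apply: eq_bigr => j _; rewrite (entry_pull_out i j j).2 mxE.
Qed.

(** Integrability of [y] is proved along with its mean because the next step of the run starts from
    it. *)
Lemma affine_step_mean (a : R) :
  let y w := (1 - a) *: x w + a *: (A w *m x w + u w) in
  (forall i, Pr.-integrable setT (EFin \o (fun w => y w i 0))) /\
  mean y = mean x + a *: ((P - 1%:M) *m mean x + v).
Proof.
move=> y.
have intu i : Pr.-integrable setT (EFin \o (fun w => u w i 0)) by case: (condu i 0).
have yE w i : y w i 0 = (1 - a) * x w i 0 + a * ((A w *m x w) i 0 + u w i 0).
  by rewrite !mxE.
have int1 i : Pr.-integrable setT (EFin \o (fun w => (1 - a) * x w i 0)).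
  exact: integrableZl (intx i).
have int2 i : Pr.-integrable setT (EFin \o (fun w => (A w *m x w) i 0 + u w i 0)).
  exact: (integrableD measurableT (intAx i) (intu i)).
have int3 i : Pr.-integrable setT (EFin \o (fun w => a * ((A w *m x w) i 0 + u w i 0))).
  exact: integrableZl (int2 i).
split=> [i|].
  have := integrableD measurableT (int1 i) (int3 i).
  by apply: eq_integrable => // w _; rewrite /= yE.
apply/colP => i; rewrite mxE; under eq_Rintegral do rewrite yE.
rewrite RintegralD// !RintegralZl// RintegralD// mean_Ax.
(* The conditional mean tested on the whole space. *)
have -> : \int[Pr]_w u w i 0 = v i 0.
  have [_ _ _ /(_ _ (@sigma_ofT _ _ _ _ x)) uv] := condu i 0.
  rewrite /Rintegral -uv integral_cst// [X in (_ * X)%E]probability_setT mule1//.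
have -> : \int[Pr]_w x w i 0 = mean x i 0 by rewrite mxE.
rewrite mulmxBl mul1mx; by move: (P *m mean x) (mean x) => Px m; rewrite !mxE; ring.
Qed.

End ConditionalMean.

(** * From mean-square convergence to convergence of the means *)

Lemma le_add_sqr_div (R : realFieldType) (k t m : R) :
  0 < k -> 0 <= t -> t <= m -> t <= k + k^-1 * m ^+ 2.
Proof.
move=> k0 t0 tm.
have -> : k + k^-1 * m ^+ 2 = (k ^+ 2 + m ^+ 2) / k by field; lra.
rewrite ler_pdivlMr//; apply: le_trans (ler_wpM2r (ltW k0) tm) _.
by have := sqr_ge0 (m - k); have := le_trans t0 tm; nra.
Qed.

Lemma norm2_sqr (R : realType) (n : nat) (v : 'cV[R]_n) : norm2 v ^+ 2 = \sum_i v i 0 ^+ 2.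
Proof. by rewrite sqr_sqrtr// sumr_ge0// => i _; exact: sqr_ge0. Qed.

Lemma measurable_norm2_sqr (d : measure_display) (T : measurableType d) (R : realType)
    (n : nat) (X : T -> 'cV[R]_n) :
  (forall i, measurable_fun setT (fun w => X w i 0)) ->
  measurable_fun setT (fun w => norm2 (X w) ^+ 2).
Proof.
move=> mX; under eq_fun do rewrite norm2_sqr.
by apply: measurable_sum => i; apply: measurable_funX.
Qed.

Lemma ms_convergent_mean (d : measure_display) (T : measurableType d) (R : realType)
    (Pr : probability T R) (n : nat) (x : nat -> T -> 'cV[R]_n) :
  (forall s i, Pr.-integrable setT (EFin \o (fun w => x s w i 0))) ->
  ms_convergent Pr x ->
  exists l : 'cV[R]_n, forall i, mean Pr (x s) i 0 @[s --> \oo] --> l i 0.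
Proof.
move=> intx [X [mX X2 xX]]; exists (mean Pr X) => i.
rewrite unlock in X2.
have mxs s k : measurable_fun setT (fun w => x s w k 0).
  by apply/measurable_EFinP; exact: measurable_int (intx s k).
have int1 (r : R) : Pr.-integrable setT (EFin \o (fun=> r)).
  exact: finite_measure_integrable_cst.
have mXs k : measurable_fun setT (fun w => X w k 0) by exact: mX.
have intX2 : Pr.-integrable setT (EFin \o (fun w => norm2 (X w) ^+ 2)).
  apply/integrableP; split; first by apply/measurable_EFinP; exact: measurable_norm2_sqr.
  by under eq_integral do rewrite gee0_abs ?lee_fin ?sqr_ge0//.
(* An absolute entry is at most 1 plus the squared norm, and constants are integrable for a
   probability. *)
have intX : Pr.-integrable setT (EFin \o (fun w => X w i 0)).
  apply: le_integrable (integrableD measurableT (int1 1) intX2) => //.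
    exact/measurable_EFinP.
  move=> w _; rewrite /= lee_fin [leRHS]ger0_norm; last by rewrite addr_ge0 ?sqr_ge0.
  have := entry_le_norm2 (X w) i; have := normr_ge0 (X w i 0); nra.
apply/cvgrPdist_le => /= e e0.
pose N s w := norm2 (x s w - X w) ^+ 2.
have mN s : measurable_fun setT (N s).
  apply: measurable_norm2_sqr => k.
  by under eq_fun do rewrite !mxE; exact: measurable_funB.
have e2 : 0 < e / 2 by lra.
have Nle : \forall s \near \oo, (\int[Pr]_w (N s w)%:E <= ((e / 2) ^+ 2)%:E)%E.
  (* The expectations are extended reals, finite only from some index on. *)
  move/fine_cvgP: xX => [finD D0].
  have De : (0 : R) < (e / 2) ^+ 2 by rewrite exprn_gt0.
  have [M1 _ finM] := finD; have [M2 _ leM] := cvgr_le _ D0 _ De.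
  exists (maxn M1 M2) => // s; rewrite /= geq_max => /andP[M1s M2s].
  have := finM s M1s; have := leM s M2s; rewrite unlock /= => Ds finDs.
  by rewrite -(fineK finDs) lee_fin.
apply: filterS Nle => s Ns.
have intdiff : Pr.-integrable setT (EFin \o (fun w => X w i 0 - x s w i 0)).
  exact: (integrableB measurableT intX (intx s i)).
rewrite !mxE -RintegralB//; apply: le_trans (le_normr_Rintegral measurableT intdiff) _.
rewrite -lee_fin fineK; last exact: (integrable_fin_num measurableT (integrable_norm intdiff)).
(* In place of Cauchy-Schwarz, [le_add_sqr_div] with [k = e / 2]: since the integral of [N s] is at
   most [(e / 2) ^+ 2], the total is at most [e]. *)
apply: (@le_trans _ _ (\int[Pr]_w ((e / 2)%:E + ((e / 2)^-1)%:E * (N s w)%:E))%E).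
  apply: ge0_le_integral => //.
  - apply/measurable_EFinP/measurableT_comp => //; exact: measurable_funB.
  - by apply/measurable_EFinP; apply: measurable_funD => //; exact: measurable_funM.
  - move=> w _; rewrite -EFinM -EFinD lee_fin.
    have := entry_le_norm2 (x s w - X w) i; rewrite !mxE distrC /N.
    by apply: le_add_sqr_div.
rewrite ge0_integralD//; last 3 first.
- by move=> w _; rewrite lee_fin ltW.
- by move=> w _; rewrite -EFinM lee_fin mulr_ge0 ?sqr_ge0// invr_ge0 ltW.
- by apply: measurable_funeM; exact/measurable_EFinP.
rewrite ge0_integralZl//; last 3 first.
- exact/measurable_EFinP.
- by move=> w _; rewrite lee_fin sqr_ge0.
- by rewrite lee_fin invr_ge0 ltW.
rewrite integral_cst// [X in (_ * X)%E]probability_setT mule1.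
apply: (@le_trans _ _ ((e / 2)%:E + ((e / 2)^-1)%:E * ((e / 2) ^+ 2)%:E)%E).
  by rewrite leeD2l// lee_wpmul2l// lee_fin invr_ge0 ltW.
rewrite -EFinM -EFinD lee_fin.
by rewrite expr2 mulKf ?gt_eqF// -splitr.
Qed.

Lemma mean_run (d : measure_display) (T : measurableType d) (R : realType)
    (Pr : probability T R) (n : nat) (Ps : nat -> T -> 'M[R]_n) (us : nat -> T -> 'cV[R]_n)
    (a : nat -> R) (x0 : 'cV[R]_n) (P : 'M[R]_n) (u : 'cV[R]_n) :
  let x := state Ps us a x0 in
  A1 Pr Ps us x P u -> ms_convergent Pr x ->
  exists m : nat -> 'cV[R]_n, exists l : 'cV[R]_n,
    [/\ m 0%N = x0,
        forall s, m s.+1 = m s + a s *: ((P - 1%:M) *m m s + u)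
      & forall i, m s i 0 @[s --> \oo] --> l i 0].
Proof.
move=> x [condP condu [C bndP] _] xcvg.
(* Integrability propagates along the run from the constant initial state. *)
have intx s i : Pr.-integrable setT (EFin \o (fun w => x s w i 0)).
  elim: s i => [i|s IHs]; first exact: finite_measure_integrable_cst.
  exact: (affine_step_mean (condP s) (condu s) (bndP s) IHs (a s)).1.
have [l ml] := ms_convergent_mean intx xcvg.
exists (fun s => mean Pr (x s)), l; split=> // [|s].
  by apply/colP => i; rewrite mxE Rintegral_cst// [X in fine X]probability_setT mulr1.
exact: (affine_step_mean (condP s) (condu s) (bndP s) (intx s) (a s)).2.
Qed.

Theorem theorem3p3 (d : measure_display) (T : measurableType d) (R : realType)
    (Pr : probability T R) (n : nat) (n_gt0 : (0 < n)%N)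
    (Ps : environment T R n 'M[R]_n) (us : environment T R n 'cV[R]_n)
    (P : 'M[R]_n) (u : 'cV[R]_n)
    (mPs : forall x0 a s, random_mx (Ps x0 a s))
    (mus : forall x0 a s, random_mx (us x0 a s)) :
  ((forall x0 a, A2 a -> A1 Pr (Ps x0 a) (us x0 a) (run Ps us x0 a) P u) ->
   rho_max P > 1 \/ (rho_max P = 1 /\ ~ A3 P u) ->
   exists x0 : 'cV[R]_n, forall a : nat -> R, A2 a ->
     ~ ms_convergent Pr (run Ps us x0 a))
  /\
  ((forall x0 a, A2' a -> A1 Pr (Ps x0 a) (us x0 a) (run Ps us x0 a) P u) ->
   rho_min P < 1 \/ (rho_min P = 1 /\ ~ A3 P u) ->
   exists x0 : 'cV[R]_n, forall a : nat -> R, A2' a ->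
     ~ ms_convergent Pr (run Ps us x0 a)).
Proof.
split=> hA1 /= hP.
  have [x0 x0P] := obstruction_diverges (obstruction_rho_max n_gt0 hP).
  exists x0 => a a2 /(mean_run (hA1 x0 a a2))[m [l [m0 mS ml]]].
  by case: a2 => a0 suma _; exact: (x0P a m l a0 suma m0 mS ml).
have [x0 x0P] := obstruction_diverges (obstruction_rho_min n_gt0 hP).
exists x0 => a a2 /(mean_run (hA1 x0 a a2))[m [l [m0 mS ml]]].
(* The signs of the gain and of the drift cancel, so the same means solve the recursion with gains
   [- a]. *)
case: a2 => a0 suma _; apply: (x0P (fun s => - a s) m l _ _ m0 _ ml) => [s||s].
- by rewrite oppr_ge0.
- have -> : series (fun s => - a s) = - series a by rewrite -seriesN.
  exact/cvgNry.
- by rewrite mS mulNmx -opprD scaleNr scalerN opprK.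
Qed.
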